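(* Let the generic algorithm described in the context be applied to $f$ and let $\epsilon>0$. Assume the following. (i) There is $\delta_S\in(0,1)$ such that for every $\bar x_k\in\mathbb{R}^d$ and $k=1,2,\dots$, $\mathbb{P}(T_k=1\mid x_k=\bar x_k)\ge 1-\delta_S$; moreover $\mathbb{P}(T_0=1)\ge 1-\delta_S$, and $T_k$ is conditionally independent of $T_0,\dots,T_{k-1}$ given $x_k=\bar x_k$. (ii) There is an iteration-independent constant $\alpha_{low}>0$ (possibly depending on $\epsilon$ and on problem and algorithm parameters) such that if iteration $k$ is true, $k<N_\epsilon$ and $\alpha_k\le\alpha_{low}$, then iteration $k$ is successful. (iii) There is a non-negative function $h:\mathbb{R}^2\to\mathbb{R}$, non-decreasing in each of its two arguments, with $h(z_1,z_2)>0$ whenever $z_1>0$ and $z_2>0$, such that if iteration $k$ is true and successful with $k<N_\epsilon$, then $f(x_k)-f(x_k+s_k)\ge h(\epsilon,\alpha_k)$. (iv) $f(x_k)\ge f(x_{k+1})$ for all $k\in\mathbb{N}$. Let $\tau_\alpha=\left\lceil \log_{\gamma_1}\left(\min\{\alpha_{low}/\alpha_0,\,1/\gamma_2\}\right)\right\rceil\in\mathbb{N}^+$ and $\alpha_{\min}=\alpha_0\gamma_1^{\tau_\alpha}$. Assume also that $\delta_S<\frac{c}{(c+1)^2}$. Suppose the algorithm runs for $N$ iterations, where $N$ is a deterministic constant. Then, for any $\delta_1\in(0,1)$ such that $g(\delta_S,\delta_1)>0$, where $$g(\delta_S,\delta_1)=\left[(1-\delta_S)(1-\delta_1)-1+\frac{c}{(c+1)^2}\right]^{-1},$$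 if $N$ satisfies $$N\ \ge\ g(\delta_S,\delta_1)\left[\frac{f(x_0)-f^*}{h(\epsilon,\alpha_0\gamma_1^{c+\tau_\alpha})}+\frac{\tau_\alpha}{1+c}\right],$$ we have $$\mathbb{P}(N\ge N_\epsilon)\ \ge\ 1-e^{-\frac{\delta_1^2}{2}(1-\delta_S)N}.$$
   Context: Here $f:\mathbb{R}^d\to\mathbb{R}$ is continuously differentiable, $f^*=\min_{x\in\mathbb{R}^d}f(x)$, and $\mathbb{N}^+$ is the set of positive integers. Generic algorithm. Choose $l\le d$ and a class of (possibly random) reduced models $\hat m_k(\hat s)=m_k(w_k(\hat s))$, $\hat s\in\mathbb{R}^l$, with prolongation functions $w_k:\mathbb{R}^l\to\mathbb{R}^d$. Choose constants $\gamma_1\in(0,1)$, $\gamma_2=\gamma_1^{-c}$ for some $c\in\mathbb{N}^+$, $\theta\in(0,1)$, $\alpha_{\max}>0$, a starting point $x_0\in\mathbb{R}^d$, and $\alpha_0=\alpha_{\max}\gamma_1^p$ for some $p\in\mathbb{N}^+$. For $k=0,1,2,\dots$: (1) compute a (possibly random) reduced model $\hat m_k$ of $f$ around $x_k$ with $\hat m_k(0)=f(x_k)$, a step parameter $\hat s_k=\hat s_k(\alpha_k)\in\mathbb{R}^l$ (the parameter $\alpha_k$ enters the model or the computation of the step parameter), and the potential step $s_k=w_k(\hat s_k)$. (2) Compute $f(x_k+s_k)$ and check whether sufficient decrease (parameterized by $\theta$) is achieved in $f$ with respect to $\hat m_k(0)-\hat m_k(\hat s_k(\alpha_k))$. (3)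 If it is achieved, set $x_{k+1}=x_k+s_k$ and $\alpha_{k+1}=\min\{\alpha_{\max},\gamma_2\alpha_k\}$ (the iteration is called successful); otherwise set $x_{k+1}=x_k$ and $\alpha_{k+1}=\gamma_1\alpha_k$ (unsuccessful). The quantities $x_k,s_k,\alpha_k$ are random variables. A (random) subset of the iterations is designated as true iterations; $T_k=1$ if iteration $k$ is true and $T_k=0$ otherwise. For $\epsilon>0$, $N_\epsilon=\inf\{M:\min_{k\le M}\|\nabla f(x_k)\|_2\le\epsilon\}$, a random variable. *)

(* Defs.v *)
From HB Require Import structures.
From mathcomp Require Import all_boot all_order all_algebra.
From mathcomp Require Import all_classical all_reals all_analysis.
Import Order.TTheory GRing.Theory Num.Theory.
Import numFieldNormedType.Exports.

Set Implicit Arguments.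
Unset Strict Implicit.
Unset Printing Implicit Defensive.

Local Open Scope classical_set_scope.
Local Open Scope ring_scope.

(* The library norm on 'rV[R]_d is the sup norm, hence a separate Euclidean
   norm. *)
Definition norm2 (R : realType) (d : nat) (x : 'rV[R]_d) : R :=
  Num.sqrt (\sum_(j < d) x ord0 j ^+ 2).

Definition grad (R : realType) (d : nat) (f : 'rV[R]_d -> R)
    (x : 'rV[R]_d) : 'rV[R]_d :=
  \row_(j < d) ('D_(delta_mx ord0 j) f x).

Definition continuously_differentiable (R : realType) (d : nat)
    (f : 'rV[R]_d -> R) : Prop :=
  (forall x, differentiable f x) /\ continuous (grad f).

Definition is_minimum (R : realType) (T : Type) (f : T -> R) (m : R) : Prop :=
  (exists x, f x = m) /\ (forall x, m <= f x).

Definition logb (R : realType) (b x : R) : R := ln x / ln b.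

(* R^d with its Borel sigma-algebra. *)
Definition borelV (R : realType) (d : nat) :=
  g_sigma_algebraType (@open 'rV[R]_d).

(* [q] is a version, with values in [0, 1], of the map
   x |-> P(A | X = x), for a random vector X. *)
Definition is_cond_prob (disp : measure_display) (Omega : measurableType disp)
    (R : realType) (P : probability Omega R) (d : nat)
    (X : Omega -> borelV R d) (A : set Omega) (q : borelV R d -> R) : Prop :=
  [/\ measurable_fun setT q,
      (forall x, 0 <= q x <= 1) &
      (forall B : set (borelV R d), measurable B ->
        P (A `&` X @^-1` B) = (\int[P]_(w in X @^-1` B) (q (X w))%:E)%E)].

(* Conditional independence given X of two random elements with finitely many
   values: P(Y = y, Z = z | X = x) = P(Y = y | X = x) P(Z = z | X = x). *)
Definition cond_independent (disp : measure_display)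
    (Omega : measurableType disp) (R : realType) (P : probability Omega R)
    (d : nat) (X : Omega -> borelV R d) (U V : finType)
    (Y : Omega -> U) (Z : Omega -> V) : Prop :=
  forall (y : U) (z : V), exists q r : borelV R d -> R,
    [/\ is_cond_prob P X [set w | Y w = y] q,
        is_cond_prob P X [set w | Z w = z] r &
        is_cond_prob P X [set w | Y w = y /\ Z w = z] (fun x => q x * r x)].

(* The sufficient decrease test is an arbitrary relation
     [suff theta (f x_k) (f (x_k + s_k)) (mhat_k 0 - mhat_k shat_k)]
   depending only on the quantities named by the algorithm. *)
Definition successful (R : realType) (d l : nat) (Omega : Type)
    (f : 'rV[R]_d -> R) (theta : R) (suff : R -> R -> R -> R -> Prop)
    (mhat : nat -> Omega -> 'rV[R]_l -> R)
    (shat : nat -> Omega -> R -> 'rV[R]_l)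
    (x s : nat -> Omega -> 'rV[R]_d) (alpha : nat -> Omega -> R)
    (k : nat) (w : Omega) : Prop :=
  suff theta (f (x k w)) (f (x k w + s k w))
    (mhat k w 0 - mhat k w (shat k w (alpha k w))).

(* All algorithmic quantities at iteration k are functions of the outcome
   [omega]: the model [m k omega], its prolongation [wk k omega], the reduced
   model [mhat k omega] and the step parameter [shat k omega], which is itself
   a function of alpha_k. *)
Record generic_algorithm (disp : measure_display)
    (Omega : measurableType disp) (R : realType) (d l : nat)
    (f : 'rV[R]_d -> R) (gamma1 gamma2 theta alpha_max alpha0 : R)
    (x0 : 'rV[R]_d) (suff : R -> R -> R -> R -> Prop)
    (m : nat -> Omega -> 'rV[R]_d -> R)
    (wk : nat -> Omega -> 'rV[R]_l -> 'rV[R]_d)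
    (mhat : nat -> Omega -> 'rV[R]_l -> R)
    (shat : nat -> Omega -> R -> 'rV[R]_l)
    (x s : nat -> Omega -> 'rV[R]_d) (alpha : nat -> Omega -> R) : Prop :=
  GenericAlgorithm {
    ga_x_meas : forall k, measurable_fun setT (x k : Omega -> borelV R d);
    ga_s_meas : forall k, measurable_fun setT (s k : Omega -> borelV R d);
    ga_alpha_meas : forall k, measurable_fun setT (alpha k);
    ga_x0 : forall omega, x 0%N omega = x0;
    ga_alpha0 : forall omega, alpha 0%N omega = alpha0;
    ga_reduced : forall k omega u, mhat k omega u = m k omega (wk k omega u);
    ga_model0 : forall k omega, mhat k omega 0 = f (x k omega);
    ga_step : forall k omega,
      s k omega = wk k omega (shat k omega (alpha k omega));
    ga_success : forall k omega,
      successful f theta suff mhat shat x s alpha k omega ->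
      x k.+1 omega = x k omega + s k omega /\
      alpha k.+1 omega = Num.min alpha_max (gamma2 * alpha k omega);
    ga_failure : forall k omega,
      ~ successful f theta suff mhat shat x s alpha k omega ->
      x k.+1 omega = x k omega /\
      alpha k.+1 omega = gamma1 * alpha k omega }.

(* N_eps = inf { M : min_(k <= M) |grad f(x_k)|_2 <= eps }, which is +oo when
   no such M exists. *)
Definition N_eps (R : realType) (d : nat) (Omega : Type) (f : 'rV[R]_d -> R)
    (x : nat -> Omega -> 'rV[R]_d) (eps : R) (omega : Omega) : \bar R :=
  ereal_inf [set M%:R%:E | M in [set M : nat |
    \big[Num.min/norm2 (grad f (x 0%N omega))]_(k < M.+1)
       norm2 (grad f (x k omega)) <= eps]].

Definition g_fun (R : realType) (c : nat) (deltaS delta1 : R) : R :=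
  ((1 - deltaS) * (1 - delta1) - 1 + c%:R / (c.+1)%:R ^+ 2)^-1.

(* Main.v *)
Require Import Defs.
From HB Require Import structures.
From mathcomp Require Import all_boot all_order all_algebra.
From mathcomp Require Import all_classical all_reals all_analysis.
From mathcomp Require Import measurable_realfun zify ring lra.
Import Order.TTheory GRing.Theory Num.Theory.
Import numFieldNormedType.Exports.

(** If the gradient has not become small during the first [N] iterations, then
    only few of these iterations can be true; but a Chernoff bound says that
    many of them are, outside an event of probability at most
    [expR (- (delta1 ^+ 2 / 2 * (1 - deltaS) * N))].

    The first claim holds along every single trajectory. The step size is
    always [alpha_max * gamma1 ^+ u] for a natural number [u], which grows by
    [1] in a failure and drops by [c], truncated at [0], in a success. A
    potential argument on [u] ([counting_bound]) shows that at least
    [c / (c + 1) ^ 2 * N - tau / (c + 1)] iterations are either false, or true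
    and successful with a step size of at least
    [alpha0 * gamma1 ^+ (c + tau)]. Each of the latter decreases [f] by
    [h eps (alpha0 * gamma1 ^+ (c + tau))] or more, so the total possible
    decrease [f x0 - fstar] limits their number, and the others are false
    ([few_true_iterations]). The lower bound assumed on [N] turns this into:
    the number of true iterations is at most [(1 - delta1) * (1 - deltaS) * N].

    For the second claim the indicators [T k] are not independent. However,
    conditional independence of [T k] from its past given [x k], together with
    the bound on [P (T k = 1 | x k)], yields
    [(1 - deltaS) * P (past = z) <= P (T k = 1, past = z)] for each value [z]
    of the past ([cond_independent_joint_ge]). This suffices to bound the
    moment generating function of the number of true iterations by induction
    ([mgf_count_le]), hence its lower tail ([chernoff_lower_tail]). *)

Set Implicit Arguments.
Unset Strict Implicit.

Local Open Scope classical_set_scope.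
Local Open Scope ring_scope.

(** * Potential and counting of iterations *)

(** The state [u] is the exponent of the step size
    [alpha = alpha_max * gamma ^+ u], which starts at [p]. The potential is
    the convex function with slope [-c] up to [p + tau] and slope [1] beyond,
    vanishing at [p]. Being a maximum of two affine functions, it is bounded
    above by bounding each of them. *)
Definition potential (c p tau u : nat) : int :=
  Num.max (c%:Z * (p%:Z - u%:Z)) (u%:Z - p%:Z - tau%:Z - c%:Z * tau%:Z).

Lemma le_potential (c p tau u : nat) (z : int) :
  (potential c p tau u <= z) =
  (c%:Z * (p%:Z - u%:Z) <= z) && (u%:Z - p%:Z - tau%:Z - c%:Z * tau%:Z <= z).
Proof. by rewrite /potential ge_max. Qed.

Lemma potential_ge (c p tau u : nat) :
  (c%:Z * (p%:Z - u%:Z) <= potential c p tau u) *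
  (u%:Z - p%:Z - tau%:Z - c%:Z * tau%:Z <= potential c p tau u).
Proof. by split; rewrite /potential le_max lexx ?orbT. Qed.

(** The minimum is reached at the kink [u = p + tau]. *)
Lemma potential_ge_min (c p tau u : nat) :
  - (c%:Z * tau%:Z) <= potential c p tau u.
Proof.
have [h1 h2] := potential_ge c p tau u.
have [hu|hu] := leqP u (p + tau)%N; last by lia.
apply: le_trans h1; rewrite -mulrN ler_wpM2l //; lia.
Qed.

Lemma potential_decr (c p tau u v : nat) : (u - c <= v <= u)%N ->
  potential c p tau v <= potential c p tau u + c%:Z * c%:Z.
Proof.
move=> huv; rewrite le_potential; have [h1 h2] := potential_ge c p tau u.
have h : 0 <= c%:Z * (c%:Z + v%:Z - u%:Z) by apply: mulr_ge0; lia.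
by apply/andP; split; nia.
Qed.

Lemma potential_incr (c p tau u : nat) :
  potential c p tau u.+1 <= potential c p tau u + 1.
Proof.
rewrite le_potential; have [h1 h2] := potential_ge c p tau u.
by apply/andP; split; nia.
Qed.

Lemma potential_incr_low (c p tau u : nat) : (u < p + tau)%N ->
  potential c p tau u.+1 + c%:Z <= potential c p tau u.
Proof.
move=> hu; rewrite -lerBrDr le_potential.
have [h1 h2] := potential_ge c p tau u.
have h : 0 <= c%:Z * (p%:Z + tau%:Z - u%:Z - 1) by apply: mulr_ge0; lia.
by apply/andP; split; nia.
Qed.

Lemma potential_decr_high (c p tau u : nat) : (p + tau + c < u)%N ->
  potential c p tau (u - c) + c%:Z <= potential c p tau u.
Proof.
move=> hu; rewrite -lerBrDr le_potential.
have [h1 h2] := potential_ge c p tau u.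
have h : 0 <= c%:Z * (u%:Z - c%:Z - p%:Z - tau%:Z) by apply: mulr_ge0; lia.
have -> : (u - c)%N%:Z = u%:Z - c%:Z by lia.
by apply/andP; split; nia.
Qed.

(** An iteration that is false, or true, successful and of exponent at most
    [p + tau + c], contributes [(c + 1) ^ 2] to the right-hand side, which
    covers the [c] on the left plus the largest possible increase of the
    potential, the maximum of [c ^ 2] and [1]. Any other iteration contributes
    nothing, but lowers the potential by at least [c]: it is either a true
    failure, which can only happen below [p + tau], where the potential has
    slope [-c], or a true success from beyond [p + tau + c], which moves [c]
    units down the part of slope [1]. Summing, the contributions cover [c * n]
    up to the total fall of the potential, at most [c * tau]. *)
Lemma counting_bound (c p tau n : nat) (u : nat -> nat) (tr su : nat -> bool) :
  u 0%N = p ->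
  (forall k, u k.+1 = if su k then (u k - c)%N else (u k).+1) ->
  (forall k, (k < n)%N -> tr k -> (p + tau <= u k)%N -> su k) ->
  (c * n <= c.+1 ^ 2 * (\sum_(k < n) ~~ tr k +
      \sum_(k < n) [&& tr k, su k & (u k <= p + tau + c)%N]) + c * tau)%N.
Proof.
move=> u0 uS htr.
suff: (c * n)%N%:Z + potential c p tau (u n) <=
  (c.+1 ^ 2 * (\sum_(k < n) ~~ tr k +
      \sum_(k < n) [&& tr k, su k & (u k <= p + tau + c)%N]))%N%:Z.
  by have := potential_ge_min c p tau (u n); lia.
elim: n htr => [|n IH] htr.
  by rewrite !big_ord0 muln0 u0 !add0r le_potential; lia.
rewrite !big_ord_recr /=.
have {}IH := IH (fun k hk => htr k (ltnW hk)).
set A := (\sum_(k < n) _)%N in IH *; set B := (\sum_(k < n) _)%N in IH *.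
suff : potential c p tau (u n.+1) + c%:Z <= potential c p tau (u n) +
   (c.+1 ^ 2 * (~~ tr n + [&& tr n, su n & (u n <= p + tau + c)%N]))%N%:Z.
  by lia.
have := htr n (ltnSn n); rewrite uS.
case: (tr n) => /=; case: (su n) => //= H.
- have [hu|hu] := leqP (u n) (p + tau + c)%N.
    by have := @potential_decr c p tau (u n) (u n - c)%N; lia.
  by have := @potential_decr_high c p tau (u n) hu; lia.
- have hu : (u n < p + tau)%N by case: ltnP => // /(H isT).
  by have := @potential_incr_low c p tau (u n) hu; lia.
- by have := @potential_decr c p tau (u n) (u n - c)%N; lia.
- by have := @potential_incr c p tau (u n); lia.
Qed.

(** Truncated subtraction is what capping the step size at [alpha_max]
    amounts to on exponents. *)
Fixpoint stepsize_exponent (c p : nat) (su : nat -> bool) (k : nat) : nat :=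
  if k is k'.+1 then
    let u := stepsize_exponent c p su k' in if su k' then (u - c)%N else u.+1
  else p.

Lemma stepsizeE (R : realFieldType) (c p : nat) (gamma alpha_max : R)
    (su : nat -> bool) (alpha : nat -> R) :
  0 < gamma < 1 -> 0 < alpha_max -> alpha 0%N = alpha_max * gamma ^+ p ->
  (forall k, alpha k.+1 = if su k
     then Num.min alpha_max (gamma ^- c * alpha k) else gamma * alpha k) ->
  forall k, alpha k = alpha_max * gamma ^+ stepsize_exponent c p su k.
Proof.
move=> /andP[g0 g1] am0 a0 aS; elim=> [//|k IH]; rewrite aS IH /=.
set u := stepsize_exponent _ _ _ _; case: (su k); last by rewrite exprS mulrCA.
have [cu|uc] := leqP c u.
- have -> : gamma ^- c * (alpha_max * gamma ^+ u) =
      alpha_max * gamma ^+ (u - c).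
    rewrite -{1}(subnK cu) exprD mulrCA (mulrC (_ ^+ (u - c)%N)).
    by rewrite mulKf ?expf_neq0 ?gt_eqF.
  by rewrite min_r // ler_piMr ?(ltW am0)// exprn_ile1 ?ltW.
- rewrite (eqP (_ : (u - c == 0)%N)) ?subn_eq0 1?ltnW// expr0 mulr1 min_l//.
  rewrite mulrCA ler_peMr ?(ltW am0)// mulrC ler_pdivlMr ?exprn_gt0// mul1r.
  by apply: ler_wiXn2l; rewrite ?ltW// ltnW.
Qed.

Lemma le_expr_of_ceil_logb (R : realType) (gamma y : R) (t : nat) :
  0 < gamma < 1 -> 0 < y -> t%:Z = Num.ceil (logb gamma y) -> gamma ^+ t <= y.
Proof.
move=> /andP[g0 g1] y0 ht.
have lg : ln gamma < 0 by rewrite ln_lt0// g0 g1.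
have : logb gamma y <= t%:R.
  by rewrite (_ : t%:R = (t%:Z)%:~R :> R)// ht ceil_ge.
rewrite /logb ler_ndivrMr// => h.
by rewrite -ler_ln ?posrE ?exprn_gt0// lnXn// -mulr_natl.
Qed.

Lemma telescope_decrease (R : numDomainType) (F : nat -> R) (good : nat -> bool)
    (b : R) (n : nat) :
  (forall k, F k.+1 <= F k) ->
  (forall k, (k < n)%N -> good k -> b <= F k - F k.+1) ->
  (\sum_(k < n) good k)%:R * b <= F 0%N - F n.
Proof.
move=> mono; elim: n => [|n IH] H; first by rewrite big_ord0 mul0r subrr.
rewrite big_ord_recr/= natrD mulrDl.
have -> : F 0%N - F n.+1 = (F 0%N - F n) + (F n - F n.+1) by ring.
apply: lerD; first by apply: IH => k hk; apply: H; rewrite ltnW.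
case: (boolP (good n)) => hn; first by rewrite mul1r H.
by rewrite mul0r subr_ge0.
Qed.

(** Along one trajectory: each iteration that is true, successful and of step
    size at least [alpha 0 * gamma ^+ (c + tau)] decreases [F] by a fixed
    amount, so there are few of them, and [counting_bound] then forces many
    false iterations. *)
Lemma few_true_iterations (R : realFieldType) (c p tau N : nat)
    (gamma alpha_max alpha_low fstar : R) (alpha F : nat -> R) (h : R -> R)
    (tr su : nat -> bool) :
  0 < gamma < 1 -> 0 < alpha_max -> alpha 0%N = alpha_max * gamma ^+ p ->
  (forall k, alpha k.+1 = if su k
     then Num.min alpha_max (gamma ^- c * alpha k) else gamma * alpha k) ->
  alpha 0%N * gamma ^+ tau <= alpha_low ->
  (forall k, (k < N)%N -> tr k -> alpha k <= alpha_low -> su k) ->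
  {homo h : z z' / z <= z'} -> 0 < h (alpha 0%N * gamma ^+ (c + tau)) ->
  (forall k, (k < N)%N -> tr k -> su k -> h (alpha k) <= F k - F k.+1) ->
  (forall k, F k.+1 <= F k) -> (forall k, fstar <= F k) ->
  c%:R * N%:R <= (c.+1)%:R ^+ 2 *
     (N%:R - (\sum_(k < N) tr k)%:R
       + (F 0%N - fstar) / h (alpha 0%N * gamma ^+ (c + tau)))
     + c%:R * tau%:R.
Proof.
move=> g01 am0 a0 aS tau_low hsu hmono hpos hdec Fmono Fge.
have aE := stepsizeE g01 am0 a0 aS.
set u := stepsize_exponent c p su in aE.
case/andP: (g01) => g0 g1.
have gle i j : (i <= j)%N -> alpha_max * gamma ^+ j <= alpha_max * gamma ^+ i.
  by move=> ij; rewrite ler_wpM2l ?(ltW am0)// ler_wiXn2l// ltW.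
have usu k : (k < N)%N -> tr k -> (p + tau <= u k)%N -> su k.
  move=> kN trk hu; apply: hsu => //; apply: le_trans tau_low.
  by rewrite [alpha k]aE a0 -mulrA -exprD gle.
have count := counting_bound (erefl : u 0%N = p) (fun k => erefl) usu.
set good := fun k => [&& tr k, su k & (u k <= p + tau + c)%N].
have hgood k : (k < N)%N -> good k ->
    h (alpha 0%N * gamma ^+ (c + tau)) <= F k - F k.+1.
  move=> kN /and3P[trk suk uk]; apply: le_trans (hdec k kN trk suk).
  by apply: hmono; rewrite [alpha k]aE a0 -mulrA -exprD gle//; lia.
have dec : (\sum_(k < N) good k)%:R <=
    (F 0%N - fstar) / h (alpha 0%N * gamma ^+ (c + tau)).
  rewrite ler_pdivlMr//; apply: le_trans (telescope_decrease Fmono hgood) _.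
  by rewrite lerD2l lerN2.
have trC : (\sum_(k < N) ~~ tr k)%:R = N%:R - (\sum_(k < N) tr k)%:R :> R.
  apply/eqP; rewrite eq_sym subr_eq -natrD -big_split /=.
  rewrite (eq_bigr (fun=> 1%N)) => [|i _]; last by case: (tr i).
  by rewrite sum1_card card_ord.
rewrite -trC -natrM; apply: (@le_trans _ _
  (c.+1 ^ 2 * (\sum_(k < N) ~~ tr k + \sum_(k < N) good k) + c * tau)%N%:R).
  by rewrite ler_nat.
by rewrite natrD natrM natrX (natrM _ c) natrD lerD2r
  ler_wpM2l ?exprn_ge0// lerD2l.
Qed.

(** * The stopping time *)

Lemma N_eps_leP (R : realType) (d : nat) (Omega : Type) (f : 'rV[R]_d -> R)
    (x : nat -> Omega -> 'rV[R]_d) (eps : R) (w : Omega) (M : nat) :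
  (N_eps f x eps w <= M%:R%:E)%E <->
  exists2 k, (k <= M)%N & norm2 (grad f (x k w)) <= eps.
Proof.
split=> [|[k kM hk]].
- move=> h; have : (N_eps f x eps w < (M.+1)%:R%:E)%E.
    by apply: le_lt_trans h _; rewrite lte_fin ltr_nat.
  move=> /ereal_inf_lt[_ [j hj <-]]; rewrite lte_fin ltr_nat ltnS => jM.
  move: hj => /=; apply: contraPP => hne; apply/negP; rewrite -ltNge.
  apply/lt_bigmin => [|i _]; rewrite ltNge; apply/negP => h0; apply: hne.
    by exists 0%N.
  by exists (i : nat) => //; rewrite (leq_trans _ jM)// -ltnS.
- apply: ge_ereal_inf; exists k%:R%:E; last by rewrite lee_fin ler_nat.
  exists k => //=.
  exact: (@bigmin_inf _ _ _ _ (@ord_max k) xpredT).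
Qed.

Lemma continuous_norm2 (R : realType) (d : nat) : continuous (@norm2 R d).
Proof.
move=> v; rewrite /norm2.
apply: (@continuous_comp _ _ _
  (fun x : 'rV[R]_d => \sum_(j < d) x ord0 j ^+ 2) Num.sqrt);
  last exact: sqrt_continuous.
have := @continuous_big R 'I_d +%R 0 xpredT (@add_continuous R) 'rV[R]_d _
  (fun j v => v ord0 j ^+ 2).
move=> H; apply: H => j _ {}v.
apply: (@continuous_comp _ _ _ (fun v : 'rV[R]_d => v ord0 j)
  (fun t => t ^+ 2)).
  exact: coord_continuous.
exact: exprn_continuous.
Qed.

(** A finite union of preimages of the set where the norm of the gradient is at
    most [eps], which is closed because the gradient is continuous. *)
Lemma measurable_N_eps_le (R : realType) (disp : measure_display)
    (Omega : measurableType disp) (d : nat) (f : 'rV[R]_d -> R)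
    (x : nat -> Omega -> 'rV[R]_d) (eps : R) (M : nat) :
  continuous (grad f) ->
  (forall k, measurable_fun setT (x k : Omega -> borelV R d)) ->
  measurable [set w | (N_eps f x eps w <= M%:R%:E)%E].
Proof.
move=> cg mx.
rewrite (_ : [set w | _] = \bigcup_(k in `I_M.+1)
  (x k @^-1` [set v | norm2 (grad f v) <= eps])); last first.
  apply/seteqP; split=> w /=.
    by move/N_eps_leP => [k kM hk]; exists k => //=; rewrite ltnS.
  by move=> [k /= kM hk]; apply/N_eps_leP; exists k.
apply: fin_bigcup_measurable; first exact: finite_II.
move=> k _; rewrite -[X in measurable X]setTI; apply: (mx k) => //.
rewrite (_ : [set _ | _] = ~` [set v | eps < norm2 (grad f v)]); last first.
  by apply/seteqP; split=> v /=; rewrite leNgt => /negP.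
apply: measurableC; apply: sub_sigma_algebra.
have cN : continuous (fun v => norm2 (grad f v)).
  move=> v; apply: (@continuous_comp _ _ _ (grad f) (@norm2 R d)).
    exact: cg.
  exact: continuous_norm2.
by have := proj1 (continuousP _) cN _ (@open_gt R eps); apply.
Qed.

(** * A quadratic bound on the exponential *)

Lemma expR_ge_quadratic (R : realType) (t : R) :
  0 <= t -> 1 + t + t ^+ 2 / 2 <= expR t.
Proof.
move=> t0.
have -> : 1 + t + t ^+ 2 / 2 = series (exp_coeff t) 3.
  rewrite /series /= !big_nat_recr//= big_geq// /exp_coeff /=.
  by rewrite expr0 expr1 !factS fact0 /=; field.
apply: nondecreasing_cvgn_le; last exact: is_cvg_series_exp_coeff.
apply/nondecreasing_seqP => n; rewrite /series /= big_nat_recr//= lerDl.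
exact: exp_coeff_ge0.
Qed.

(** Follows from the lower bound at [t], because
    [(1 - t + t ^+ 2 / 2) * (1 + t + t ^+ 2 / 2) = 1 + t ^+ 4 / 4]. *)
Lemma expRN_le_quadratic (R : realType) (t : R) :
  0 <= t -> expR (- t) <= 1 - t + t ^+ 2 / 2.
Proof.
move=> t0; rewrite expRN -[leLHS]mul1r ler_pdivrMr ?expR_gt0//.
have q0 : 0 <= 1 - t + t ^+ 2 / 2 by nra.
apply: (le_trans _ (ler_wpM2l q0 (expR_ge_quadratic t0))).
have -> : (1 - t + t ^+ 2 / 2) * (1 + t + t ^+ 2 / 2) = 1 + (t ^+ 2 / 2) ^+ 2.
  by field.
by rewrite lerDl sqr_ge0.
Qed.

(** * Conditional probabilities *)

(** Versions of a conditional probability agree almost surely, so a pointwise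
    lower bound for one of them transfers to the others. It suffices to look
    at the event [q' (X w) < mu]: the integrals of [q (X w)] and [q' (X w)]
    over it coincide and the former is at least that of [mu], so
    [mu - q' (X w)], which is positive there, has integral [0]. *)
Lemma cond_prob_version_ge (R : realType) (disp : measure_display)
    (Omega : measurableType disp) (P : probability Omega R) (d : nat)
    (X : Omega -> borelV R d) (A : set Omega)
    (q q' : borelV R d -> R) (mu : R) :
  measurable_fun setT X ->
  measurable A -> is_cond_prob P X A q -> is_cond_prob P X A q' ->
  (forall v, mu <= q v) ->
  {ae P, forall w, mu <= q' (X w)}.
Proof.
move=> mX mA [mq q01 qE] [mq' q'01 q'E] muq.
pose B : set (borelV R d) := q' @^-1` `]-oo, mu[%classic.
have mB : measurable B by rewrite -[B]setTI; exact: mq'.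
have mD : measurable (X @^-1` B).
  by rewrite -[X in measurable X]setTI; exact: mX.
set D := X @^-1` B in mD *.
have mq'X : measurable_fun setT (q' \o X) by exact: measurableT_comp.
have mqX : measurable_fun setT (q \o X) by exact: measurableT_comp.
have DP w : D w -> q' (X w) < mu by rewrite /D /B /= in_itv /=.
have I0 : (\int[P]_(w in D) (mu - q' (X w))%:E = 0)%E.
  apply/eqP; rewrite eq_le; apply/andP; split; last first.
    by apply: integral_ge0 => w /DP h; rewrite lee_fin subr_ge0 ltW.
  have fin : (\int[P]_(w in D) (q' (X w))%:E)%E \is a fin_num.
    by rewrite -q'E// fin_num_measure//; exact: measurableI.
  rewrite -(leeD2lE _ _ fin) adde0 -ge0_integralD//; last 4 first.
  - by move=> w _; rewrite lee_fin; case/andP: (q'01 (X w)).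
  - by apply/measurable_EFinP/measurable_funTS.
  - by move=> w /DP h; rewrite lee_fin subr_ge0 ltW.
  - by apply/measurable_EFinP/measurable_funTS/measurable_funB.
  rewrite -q'E// qE//; apply: ge0_le_integral => //.
  - move=> w /DP h; rewrite -EFinD addrC subrK lee_fin.
    by apply: (le_trans _ (ltW h)); case/andP: (q'01 (X w)).
  - under eq_fun do rewrite -EFinD addrC subrK.
    exact: measurable_cst.
  - by apply/measurable_EFinP/measurable_funTS.
  - by move=> w _; rewrite -EFinD addrC subrK lee_fin.
have J0 : (\int[P]_(w in D) `|(mu - q' (X w))%:E| = 0)%E.
  rewrite -[RHS]I0; apply: eq_integral => w /[!inE] /DP h.
  by rewrite gee0_abs// lee_fin subr_ge0 ltW.
move/(ae_eq_integral_abs _ mD _).1 : J0.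
move=> /(_ _) [|M [mM M0 sM]].
  by apply/measurable_EFinP/measurable_funTS/measurable_funB.
exists M; split=> // w /= /negP; rewrite -ltNge => h; apply: sM => /=.
have Dw : D w by rewrite /D /B /= in_itv /=.
by move=> /(_ Dw) [] /eqP; rewrite subr_eq0 gt_eqF.
Qed.

Lemma measurable_bool_fiber (disp : measure_display)
    (Omega : measurableType disp) (Y : Omega -> bool) (b : bool) :
  measurable_fun setT Y -> measurable [set w | Y w = b].
Proof.
move=> mY; rewrite -[X in measurable X]setTI.
exact: (mY measurableT [set b]).
Qed.

(** Given [X], the joint conditional probability is the product [q' * r], and
    [q' >= mu] almost surely; integrating [q' * r >= mu * r] removes the
    conditioning. *)
Lemma cond_independent_joint_ge (R : realType) (disp : measure_display)
    (Omega : measurableType disp) (P : probability Omega R) (d : nat)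
    (X : Omega -> borelV R d) (V : finType) (Y : Omega -> bool) (Z : Omega -> V)
    (q : borelV R d -> R) (mu : R) (v : V) :
  measurable_fun setT X -> measurable_fun setT Y ->
  is_cond_prob P X [set w | Y w = true] q -> 0 <= mu -> (forall x, mu <= q x) ->
  cond_independent P X Y Z ->
  (mu%:E * P [set w | Z w = v] <= P [set w | Y w = true /\ Z w = v])%E.
Proof.
move=> mX mY hq mu0 muq /(_ true v) [q' [r [hq' hr hqr]]].
have mYt := measurable_bool_fiber true mY.
have ae := cond_prob_version_ge mX mYt hq hq' muq.
case: hq' hr hqr => mq' q'01 _ [mr r01 rE] [_ _ qrE].
have {}rE := rE _ (measurableT); have {}qrE := qrE _ measurableT.
rewrite preimage_setT !setIT in rE qrE.
have mrX : measurable_fun setT (r \o X) by exact: measurableT_comp.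
have mq'X : measurable_fun setT (q' \o X) by exact: measurableT_comp.
rewrite rE qrE -ge0_integralZl_EFin//; last 2 first.
- by move=> w _; rewrite lee_fin; case/andP: (r01 (X w)).
- exact/measurable_EFinP.
apply: ae_ge0_le_integral => //.
- by move=> w _; rewrite -EFinM lee_fin mulr_ge0//; case/andP: (r01 (X w)).
- by apply/measurable_EFinP; exact: measurable_funM.
- move=> w _; rewrite lee_fin mulr_ge0//; first by case/andP: (q'01 (X w)).
  by case/andP: (r01 (X w)).
- by apply/measurable_EFinP; exact: measurable_funM.
apply: filterS ae => w h _; rewrite -EFinM lee_fin ler_wpM2r//.
by case/andP: (r01 (X w)).
Qed.

(** * Lower tail of the number of true iterations *)

Section finite_valued.
Context (R : realType) (disp : measure_display)
  (Omega : measurableType disp) (P : probability Omega R) (U : finType).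
Variables (Z : Omega -> U) (mZ : forall u, measurable [set w | Z w = u]).

Lemma measurable_fun_finite_valued d' (V : measurableType d') (phi : U -> V) :
  measurable_fun setT (phi \o Z).
Proof.
move=> _ B mB; rewrite setTI.
rewrite (_ : _ @^-1` _ = \bigcup_(u in [set u | B (phi u)]) [set w | Z w = u]).
  by apply: fin_bigcup_measurable => //; exact: finite_finset.
apply/seteqP; split=> w /=; first by exists (Z w).
by move=> [u /= ? ->].
Qed.

Lemma integral_finite_valued (D : set Omega) (phi : U -> R) :
  measurable D -> (forall u, 0 <= phi u) ->
  (\int[P]_(w in D) (phi (Z w))%:E =
   \sum_(u : U) (phi u)%:E * P (D `&` [set w | Z w = u]))%E.
Proof.
move=> mD phi0.
rewrite (eq_integral
  (fun w => \sum_(u : U) (phi u * \1_[set w | Z w = u] w)%:E)%E).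
  rewrite ge0_integral_sum//; last 2 first.
  - by move=> u; apply/measurable_EFinP/measurable_funTS/measurable_funM.
  - by move=> u w _; rewrite lee_fin mulr_ge0.
  apply: eq_bigr => u _.
  under eq_integral do rewrite EFinM.
  rewrite ge0_integralZl_EFin//.
  - by rewrite integral_indic// setIC.
  - by apply/measurable_EFinP/measurable_funTS.
move=> w _; rewrite sumEFin (bigD1 (Z w))//= big1 ?addr0.
  by rewrite indicE mem_set// mulr1.
move=> u uZ; rewrite indicE memNset ?mulr0// => /= /eqP.
by rewrite eq_sym (negPf uZ).
Qed.

End finite_valued.

Section lower_tail.
Context (R : realType) (disp : measure_display)
  (Omega : measurableType disp) (P : probability Omega R).
Variables (T : nat -> Omega -> bool) (mT : forall k, measurable_fun setT (T k)).

Let history n (w : Omega) : {ffun 'I_n -> bool} := [ffun i : 'I_n => T i w].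

Let measurable_history n (z : {ffun 'I_n -> bool}) :
  measurable [set w | history n w = z].
Proof.
rewrite (_ : [set w | _] = \bigcap_(i in [set: 'I_n]) [set w | T i w = z i]).
  apply: fin_bigcap_measurable => // i _.
  exact: measurable_bool_fiber.
apply/seteqP; split=> w /=; first by move=> <- i _; rewrite ffunE.
by move=> h; apply/ffunP => i; rewrite ffunE h.
Qed.

Let count_history n w :
  (\sum_(i < n) T i w)%N = (\sum_(i < n) history n w i)%N.
Proof. by apply: eq_bigr => i _; rewrite ffunE. Qed.

Lemma measurable_count d' (V : measurableType d') (g : nat -> V) n :
  measurable_fun setT (fun w => g (\sum_(i < n) T i w)%N).
Proof.
under eq_fun do rewrite count_history.
exact: (measurable_fun_finite_valued (@measurable_history n)
  (fun z => g (\sum_(i < n) z i)%N)).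
Qed.

Lemma measurable_count_le n (r : R) :
  measurable [set w | (\sum_(i < n) T i w)%:R <= r].
Proof.
have := measurable_count (fun j => j%:R : R) n measurableT
  (measurable_itv `]-oo, r]).
by rewrite setTI set_itvE.
Qed.

Variable (mu : R) (mu01 : 0 <= mu <= 1).
Hypothesis joint_ge : forall k (z : {ffun 'I_k -> bool}),
  (mu%:E * P [set w | history k w = z] <=
   P [set w | T k w = true /\ history k w = z])%E.

(** Sum of the hypothesis [joint_ge] over all histories, each weighted by the
    value of [g] at its number of true iterations. *)
Let next_true_ge n (g : nat -> R) : (forall j, 0 <= g j) ->
  (mu%:E * \int[P]_w (g (\sum_(i < n) T i w)%N)%:E <=
   \int[P]_(w in [set w | T n w = true]) (g (\sum_(i < n) T i w)%N)%:E)%E.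
Proof.
move=> g0; have mTn : measurable [set w | T n w = true].
  exact: measurable_bool_fiber.
under eq_integral do rewrite count_history.
under [leRHS]eq_integral do rewrite count_history.
rewrite !(integral_finite_valued P (@measurable_history n)
  (phi := fun z => g (\sum_(i < n) z i)%N))//.
rewrite ge0_sume_distrr; last by move=> z _; rewrite mule_ge0// lee_fin.
apply: lee_sum => z _; rewrite setTI muleCA lee_wpmul2l ?lee_fin//.
exact: joint_ge.
Qed.

Variables (lam : R) (lam01 : 0 < lam <= 1).

Let fin_mgf n (D : set Omega) : measurable D ->
  (\int[P]_(w in D) (lam ^+ (\sum_(i < n) T i w))%:E)%E \is a fin_num.
Proof.
case/andP: lam01 => l0 l1 mD; rewrite ge0_fin_numE; last first.
  by apply: integral_ge0 => w _; rewrite lee_fin exprn_ge0// ltW.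
apply: (@le_lt_trans _ _ (\int[P]_(w in D) (cst 1 w))%E).
  apply: ge0_le_integral => //.
  - by move=> w _; rewrite lee_fin exprn_ge0// ltW.
  - by apply/measurable_EFinP/measurable_funTS; exact: measurable_count.
  - by move=> w _; rewrite lee_fin exprn_ile1// ltW.
by rewrite integral_cst// mul1e (le_lt_trans (probability_le1 _ mD))// ltry.
Qed.

(** Splitting on [T n], the next factor multiplies the integrand by [lam] on an
    event that carries at least a proportion [mu] of the integral. *)
Lemma mgf_count_le n :
  (\int[P]_w (lam ^+ (\sum_(i < n) T i w))%:E <=
   ((1 - (1 - lam) * mu) ^+ n)%:E)%E.
Proof.
case/andP: (lam01) => l0 l1; case/andP: (mu01) => mu0 mu1.
elim: n => [|n IH].
  under eq_integral do rewrite big_ord0 expr0.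
  by rewrite expr0 (integral_cst P measurableT 1) mul1e probability_le1.
have mD : measurable [set w | T n w = true].
  exact: measurable_bool_fiber.
set D := [set w | T n w = true] in mD.
have split_int (g : Omega -> R) :
    measurable_fun setT g -> (forall w, 0 <= g w) ->
    (\int[P]_w (g w)%:E =
     \int[P]_(w in D) (g w)%:E + \int[P]_(w in ~` D) (g w)%:E)%E.
  move=> mg g0; rewrite -ge0_integral_setU//.
  - by rewrite setUv.
  - exact: measurableC.
  - by rewrite setUv; exact/measurable_EFinP.
  - by move=> w _; rewrite lee_fin.
  - exact/disj_setPCl.
have lge0 k w : 0 <= lam ^+ (\sum_(i < k) T i w) by rewrite exprn_ge0// ltW.
have := @next_true_ge n (fun j => lam ^+ j) (fun j => exprn_ge0 j (ltW l0)).
move: IH; rewrite !split_int//; try exact: measurable_count.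
rewrite -/D.
have -> : (\int[P]_(w in D) (lam ^+ (\sum_(i < n.+1) T i w))%:E =
    lam%:E * \int[P]_(w in D) (lam ^+ (\sum_(i < n) T i w))%:E)%E.
  rewrite -ge0_integralZl_EFin ?ltW//.
  - apply: eq_integral => w; rewrite inE /D /= => Tw.
    by rewrite big_ord_recr /= Tw addn1 exprS EFinM.
  - by move=> w _; rewrite lee_fin.
  - by apply/measurable_EFinP/measurable_funTS; exact: measurable_count.
have -> : (\int[P]_(w in ~` D) (lam ^+ (\sum_(i < n.+1) T i w))%:E =
    \int[P]_(w in ~` D) (lam ^+ (\sum_(i < n) T i w))%:E)%E.
  apply: eq_integral => w; rewrite inE /D /= => /negP/negPf Tw.
  by rewrite big_ord_recr /= Tw addn0.
have := fin_mgf n mD; have := fin_mgf n (measurableC mD).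
move: (\int[P]_(w in _) _)%E => b; move: (\int[P]_(w in _) _)%E => a.
case: b => // b _; case: a => // a _.
rewrite -?EFinM -?EFinD -?EFinM -?EFinD !lee_fin exprS => h1 h2.
have h3 : 0 <= (1 - lam) * mu by rewrite mulr_ge0// subr_ge0.
have : (1 - (1 - lam) * mu) * (a + b) <=
    (1 - (1 - lam) * mu) * (1 - (1 - lam) * mu) ^+ n.
  apply: ler_wpM2l => //; nra.
apply: le_trans; nra.
Qed.

End lower_tail.

(** Exponential Markov inequality with parameter [lam = expR (- delta)]. The
    optimal parameter is [1 - delta], but this one already gives the exponent
    [delta ^+ 2 / 2 * mu * n], using only
    [expR (- delta) <= 1 - delta + delta ^+ 2 / 2]. *)
Lemma chernoff_lower_tail (R : realType) (disp : measure_display)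
    (Omega : measurableType disp) (P : probability Omega R)
    (T : nat -> Omega -> bool) (mu delta : R) (n : nat) :
  (forall k, measurable_fun setT (T k)) -> 0 <= mu <= 1 -> 0 <= delta ->
  (forall k (z : {ffun 'I_k -> bool}),
    (mu%:E * P [set w | [ffun i : 'I_k => T i w] = z] <=
     P [set w | T k w = true /\ [ffun i : 'I_k => T i w] = z])%E) ->
  (P [set w | ((\sum_(i < n) T i w)%:R <= (1 - delta) * mu * n%:R)%R] <=
   (expR (- (delta ^+ 2 / 2 * mu * n%:R)))%:E)%E.
Proof.
move=> mT mu01 delta0 joint_ge; case/andP: (mu01) => mu0 mu1.
set lam := expR (- delta).
have lam01 : 0 < lam <= 1 by rewrite expR_gt0 expR_le1 oppr_le0.
set r := (1 - delta) * mu * n%:R.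
set D := [set w | _].
have mD : measurable D := measurable_count_le mT _ _.
have mlam : measurable_fun setT (fun w => lam ^+ (\sum_(i < n) T i w)%N).
  exact: (measurable_count mT (fun j => lam ^+ j)).
have lam_ge0 w : (0 <= (lam ^+ (\sum_(i < n) T i w))%:E)%E.
  by rewrite lee_fin exprn_ge0// expR_ge0.
have markov : ((expR (- delta * r))%:E * P D <=
    ((1 - (1 - lam) * mu) ^+ n)%:E)%E.
  apply: le_trans (mgf_count_le mT mu01 joint_ge lam01 n).
  apply: (@le_trans _ _ (\int[P]_(w in D) (lam ^+ (\sum_(i < n) T i w))%:E)%E).
    rewrite -integral_cst//; apply: ge0_le_integral => //.
    - by move=> w _; rewrite lee_fin expR_ge0.
    - by apply/measurable_EFinP/measurable_funTS.
    - move=> w Dw; rewrite lee_fin -expRM_natl ler_expR mulrC.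
      by rewrite ler_wnM2r// oppr_le0.
  by apply: ge0_subset_integral => //; exact/measurable_EFinP.
have Pfin : P D \is a fin_num by rewrite fin_num_measure.
move: markov; rewrite -(fineK Pfin) -EFinM !lee_fin => markov.
have rate : (1 - (1 - lam) * mu) ^+ n <=
    expR (- (delta - delta ^+ 2 / 2) * mu * n%:R).
  rewrite (mulrC _ n%:R) expRM_natl; apply: lerXn2r;
    rewrite ?nnegrE ?expR_ge0//.
    case/andP: lam01 => l0 l1; nra.
  apply: le_trans (expR_ge1Dx _); rewrite -mulNr lerD2l ler_wpM2r//.
  by have := expRN_le_quadratic delta0; rewrite -/lam; lra.
have := le_trans markov rate; rewrite -ler_pdivlMl ?expR_gt0// -expRN -expRD.
by congr (_ <= expR _); rewrite /r; field.
Qed.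

(** * The complexity bound *)

Unset Implicit Arguments.

Theorem theorem2p1 (R : realType) (disp : measure_display)
    (Omega : measurableType disp) (P : probability Omega R)
    (d l : nat) (f : 'rV[R]_d -> R) (fstar : R)
    (hf : continuously_differentiable f) (hfstar : is_minimum f fstar)
    (* algorithm parameters *)
    (hld : (l <= d)%N)
    (c p : nat) (hc : (0 < c)%N) (hp : (0 < p)%N)
    (gamma1 gamma2 theta alpha_max alpha0 : R)
    (hgamma1 : 0 < gamma1 < 1) (hgamma2 : gamma2 = gamma1 ^- c)
    (htheta : 0 < theta < 1) (halpha_max : 0 < alpha_max)
    (halpha0 : alpha0 = alpha_max * gamma1 ^+ p)
    (x0 : 'rV[R]_d) (suff : R -> R -> R -> R -> Prop)
    (* a run of the algorithm *)
    (m : nat -> Omega -> 'rV[R]_d -> R)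
    (wk : nat -> Omega -> 'rV[R]_l -> 'rV[R]_d)
    (mhat : nat -> Omega -> 'rV[R]_l -> R)
    (shat : nat -> Omega -> R -> 'rV[R]_l)
    (x s : nat -> Omega -> 'rV[R]_d) (alpha : nat -> Omega -> R)
    (hrun : generic_algorithm f gamma1 gamma2 theta alpha_max alpha0 x0 suff
              m wk mhat shat x s alpha)
    (* true iterations *)
    (T : nat -> Omega -> bool) (hT : forall k, measurable_fun setT (T k))
    (eps : R) (heps : 0 < eps)
    (* (i) *)
    (deltaS : R) (hdeltaS : 0 < deltaS < 1)
    (hTcond : forall k, (0 < k)%N ->
       exists q : borelV R d -> R,
         is_cond_prob P (x k) [set omega | T k omega = true] q /\
         (forall xbar, 1 - deltaS <= q xbar))
    (hT0 : ((1 - deltaS)%:E <= P [set omega | T 0%N omega = true])%E)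
    (hTindep : forall k, (0 < k)%N ->
       cond_independent P (x k) (T k)
         (fun omega => [ffun i : 'I_k => T i omega]))
    (* (ii) *)
    (alpha_low : R) (halpha_low : 0 < alpha_low)
    (hsucc : forall k omega, T k omega = true ->
       (k%:R%:E < N_eps f x eps omega)%E -> alpha k omega <= alpha_low ->
       successful f theta suff mhat shat x s alpha k omega)
    (* (iii) *)
    (h : R -> R -> R)
    (h_ge0 : forall z1 z2, 0 <= h z1 z2)
    (h_mono1 : forall z1 z1' z2, z1 <= z1' -> h z1 z2 <= h z1' z2)
    (h_mono2 : forall z1 z2 z2', z2 <= z2' -> h z1 z2 <= h z1 z2')
    (h_gt0 : forall z1 z2, 0 < z1 -> 0 < z2 -> 0 < h z1 z2)
    (hdecr : forall k omega, T k omega = true ->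
       successful f theta suff mhat shat x s alpha k omega ->
       (k%:R%:E < N_eps f x eps omega)%E ->
       h eps (alpha k omega) <= f (x k omega) - f (x k omega + s k omega))
    (* (iv) *)
    (hmono : forall k omega, f (x k.+1 omega) <= f (x k omega))
    (tau : nat)
    (htau : tau%:Z =
       Num.ceil (logb gamma1 (Num.min (alpha_low / alpha0) (1 / gamma2))))
    (hdeltaSc : deltaS < c%:R / (c.+1)%:R ^+ 2)
    (N : nat) (delta1 : R) (hdelta1 : 0 < delta1 < 1)
    (hg : 0 < g_fun c deltaS delta1)
    (hN : g_fun c deltaS delta1 *
          ((f x0 - fstar) / h eps (alpha0 * gamma1 ^+ (c + tau))
           + tau%:R / (1 + c)%:R) <= N%:R) :
  ((1 - expR (- (delta1 ^+ 2 / 2 * (1 - deltaS) * N%:R)))%:E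
     <= P [set omega | (N_eps f x eps omega <= N%:R%:E)%E])%E.
Proof.
have mx := ga_x_meas hrun.
have mE := measurable_N_eps_le eps N (proj2 hf) mx.
have [_ fmin] := hfstar.
case/andP: (hdeltaS) => dS0 dS1; case/andP: (hdelta1) => d10 d11.
set mu := 1 - deltaS.
have mu01 : 0 <= mu <= 1 by rewrite /mu; lra.
have joint_ge k (z : {ffun 'I_k -> bool}) :
    (mu%:E * P [set w | [ffun i : 'I_k => T i w] = z] <=
     P [set w | T k w = true /\ [ffun i : 'I_k => T i w] = z])%E.
  (* At [k = 0] the history is empty. *)
  case: k z => [|k] z.
    have allz (w : Omega) : [ffun i : 'I_0 => T i w] = z by apply/ffunP => -[].
    rewrite (_ : [set w | _ = z] = setT); last first.
      by apply/seteqP; split=> // w _; exact: allz.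
    rewrite (_ : [set w | _ /\ _] = [set w | T 0%N w = true]).
      by rewrite probability_setT mule1.
    by apply/seteqP; split=> w //= [].
  have [q [hq muq]] := hTcond k.+1 isT.
  apply: cond_independent_joint_ge hq _ muq (hTindep k.+1 isT) => //.
  by case/andP: mu01.
have tail := chernoff_lower_tail N hT mu01 (ltW d10) joint_ge.
set few := [set w | _] in tail.
(* A trajectory with [N < N_eps] has at most [(1 - delta1) * mu * N] true
   iterations. *)
have sub : ~` [set w | (N_eps f x eps w <= N%:R%:E)%E] `<=` few.
  move=> w /= /negP; rewrite -ltNge => run.
  rewrite /few /= leNgt; apply/negP => many.
  have running k : (k < N)%N -> (k%:R%:E < N_eps f x eps w)%E.
    by move=> kN; apply: le_lt_trans run; rewrite lee_fin ler_nat ltnW.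
  pose su k := `[< successful f theta suff mhat shat x s alpha k w >].
  have a0 : alpha 0%N w = alpha0 := ga_alpha0 hrun w.
  have a0pos : 0 < alpha0.
    by rewrite halpha0 mulr_gt0// exprn_gt0//; case/andP: hgamma1.
  have low : alpha 0%N w * gamma1 ^+ tau <= alpha_low.
    rewrite a0 mulrC -ler_pdivlMr//.
    have [g0 g1] := andP hgamma1.
    have pos : 0 < Num.min (alpha_low / alpha0) (1 / gamma2).
      by rewrite lt_min !divr_gt0// hgamma2 invr_gt0 exprn_gt0.
    by have := le_expr_of_ceil_logb hgamma1 pos htau; rewrite le_min => /andP[].
  have := @few_true_iterations R c p tau N gamma1 alpha_max alpha_low fstar
    (alpha ^~ w) (fun k => f (x k w)) (h eps) (T ^~ w) su hgamma1 halpha_max _ _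
    low _ _ _ _ (fun k => hmono k w) (fun k => fmin _).
  rewrite a0 => H.
  have {}H := H halpha0.
  have {}H : c%:R * N%:R <= (c.+1)%:R ^+ 2 *
     (N%:R - (\sum_(k < N) T k w)%:R
       + (f (x 0%N w) - fstar) / h eps (alpha0 * gamma1 ^+ (c + tau)))
     + c%:R * tau%:R.
    apply: H.
    - move=> k; rewrite /su -hgamma2; case: asboolP => hk.
        by case: (ga_success hrun hk).
      by case: (ga_failure hrun hk).
    - move=> k kN Tk ak; apply/asboolP; apply: hsucc => //; exact: running.
    - by move=> z z'; exact: h_mono2.
    - by apply: h_gt0 => //; rewrite mulr_gt0// exprn_gt0//; case/andP: hgamma1.
    - move=> k kN Tk /asboolP hk.
      rewrite (proj1 (ga_success hrun hk)).
      by apply: hdecr => //; exact: running.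
  move: H hN; rewrite (ga_x0 hrun w) => H.
  move: hg; rewrite /g_fun invr_gt0 => D0.
  rewrite mulrC ler_pdivrMr// => H2.
  move: many; rewrite -subr_gt0 => many.
  have K0 : 0 < (c.+1)%:R :> R by rewrite ltr0n.
  set q := _ / h _ _ in H H2; set S := (\sum_(k < N) T k w)%:R in H many.
  (* Once the denominators of the bound on [N] are cleared, it contradicts
     [many] because [c * tau <= tau * (c + 1)]. *)
  have : (c.+1)%:R ^+ 2 * (q + tau%:R / (1 + c)%:R) <= (c.+1)%:R ^+ 2 *
     (N%:R * ((1 - deltaS) * (1 - delta1) - 1 + c%:R / c.+1%:R ^+ 2)).
    by rewrite ler_wpM2l// exprn_ge0// ltW.
  have -> : (c.+1)%:R ^+ 2 * (q + tau%:R / (1 + c)%:R) =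
     (c.+1)%:R ^+ 2 * q + tau%:R * (c.+1)%:R.
    by rewrite add1n; field; rewrite gt_eqF.
  have -> : (c.+1)%:R ^+ 2 *
     (N%:R * ((1 - deltaS) * (1 - delta1) - 1 + c%:R / c.+1%:R ^+ 2)) =
     (c.+1)%:R ^+ 2 * ((1 - delta1) * mu * N%:R - N%:R) + c%:R * N%:R.
    by rewrite /mu; field; rewrite gt_eqF.
  have := mulr_gt0 (exprn_gt0 2 K0) many.
  have t0 : 0 <= tau%:R :> R by rewrite ler0n.
  have -> : tau%:R * (c.+1)%:R = c%:R * tau%:R + tau%:R :> R.
    by rewrite -natr1; ring.
  move: H; rewrite -/mu; move: (c.+1%:R ^+ 2) => K2; lra.
have mfew : measurable few := measurable_count_le hT _ _.
have : (P (~` [set w | (N_eps f x eps w <= N%:R%:E)%E]) <=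
    (expR (- (delta1 ^+ 2 / 2 * (1 - deltaS) * N%:R)))%:E)%E.
  apply: le_trans tail; apply: le_measure; rewrite ?inE//.
  exact: measurableC.
rewrite probability_setC// -(fineK (fin_num_measure P _ mE)) -EFinB !lee_fin.
by rewrite -/mu; lra.
Qed.
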